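(* In the affine setting described in the context, let $\sigma\in(0,1]$ and let $f,\alpha,s:I^q\to\mathbb{R}$ be Hölder continuous with exponent $\sigma$, with $s(x_{1,j_1},\dots,x_{q,j_q})=f(x_{1,j_1},\dots,x_{q,j_q})$ for all $(j_1,\dots,j_q)\in\prod_{k=1}^q\{0,M_k\}$. Let $a=\min\{|a_{k,i}|:1\le k\le q,\ 1\le i\le M_k\}$ and suppose $\max\big\{\|\alpha\|_\infty/a^\sigma,\ \|\alpha\|\big\}<1$, where $\|\alpha\|=\|\alpha\|_\infty+[\alpha]_\sigma$. Then the $\alpha$-fractal function $f^\alpha$ is Hölder continuous with exponent $\sigma$. Moreover, $$q\le\dim_H\mathcal{G}(f^\alpha)\le\underline{\dim}_B\mathcal{G}(f^\alpha)\le\overline{\dim}_B\mathcal{G}(f^\alpha)\le q+1-\sigma.$$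
   Context: Affine setting: $I=[0,1]$; for each $k\in\{1,\dots,q\}$, $M_k\ge2$ and $0=x_{k,0}<\dots<x_{k,M_k}=1$, $I_{k,i}=[x_{k,i-1},x_{k,i}]$. For $1\le i\le M_k$, $u_{k,i}:I\to I_{k,i}$ is affine, $u_{k,i}(x)=a_{k,i}x+b_{k,i}$, with $a_{k,i}=x_{k,i}-x_{k,i-1}$, $b_{k,i}=x_{k,i-1}$ if $i$ is odd and $a_{k,i}=x_{k,i-1}-x_{k,i}$, $b_{k,i}=x_{k,i}$ if $i$ is even. For $i=(i_1,\dots,i_q)$, $u_i(y)=(u_{1,i_1}(y_1),\dots,u_{q,i_q}(y_q))$. Given $f,\alpha,s\in\mathcal{C}(I^q)$ with $\|\alpha\|_\infty<1$ and $s=f$ at the vertices of $I^q$, the $\alpha$-fractal function $f^\alpha$ is the unique continuous $f^\alpha:I^q\to\mathbb{R}$ with $f^\alpha(x)=f(x)+\alpha(x)[f^\alpha(u_i^{-1}(x))-s(u_i^{-1}(x))]$ for all $i\in\prod_k\{1,\dots,M_k\}$ and $x\in\prod_k I_{k,i_k}$. Hölder: $|h(x)-h(y)|\le K\|x-y\|_2^\sigma$; $[h]_\sigma=\sup_{x\ne y}|h(x)-h(y)|/\|x-y\|_2^\sigma$. $\mathcal{G}(g)=\{(x,g(x)):x\in I^q\}$; $\dim_H,\underline{\dim}_B,\overline{\dim}_B$ are Hausdorff, lower box, upper box dimension. *)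

(* Defs.v *)
From HB Require Import structures.
From mathcomp Require Import all_boot all_order all_algebra.
From mathcomp Require Import all_classical all_reals all_analysis.
Set Implicit Arguments. Unset Strict Implicit. Unset Printing Implicit Defensive.
Import Order.TTheory GRing.Theory Num.Theory.
Import numFieldNormedType.Exports.
Local Open Scope classical_set_scope.
Local Open Scope ring_scope.

Section Defs.
Variable R : realType.

Definition euclid n (v : 'rV[R]_n) : R := Num.sqrt (\sum_(i < n) (v 0 i) ^+ 2).

Definition cube q : set 'rV[R]_q := [set x | forall k : 'I_q, 0 <= x 0 k <= 1].

Definition holder_on q (sig : R) (h : 'rV[R]_q -> R) : Prop :=
  exists K : R, forall x y, @cube q x -> @cube q y ->
    `|h x - h y| <= K * (euclid (x - y)) `^ sig.

Definition supnorm q (h : 'rV[R]_q -> R) : R := sup [set `|h x| | x in @cube q].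

Definition holder_semi q (sig : R) (h : 'rV[R]_q -> R) : R :=
  sup [set r | exists x y : 'rV[R]_q, @cube q x /\ @cube q y /\ y != x /\
        r = `|h x - h y| / (euclid (x - y)) `^ sig].

(** affine data: partition points xs k 0 = 0 < ... < xs k (M k) = 1 *)
Definition acoef (xs : nat -> R) (i : nat) : R :=
  if odd i then xs i - xs i.-1 else xs i.-1 - xs i.
Definition bcoef (xs : nat -> R) (i : nat) : R :=
  if odd i then xs i.-1 else xs i.

Definition uki (xs : nat -> R) (i : nat) (y : R) : R := acoef xs i * y + bcoef xs i.
Definition uki_inv (xs : nat -> R) (i : nat) (x : R) : R :=
  (x - bcoef xs i) / acoef xs i.

Definition u_map q (xs : 'I_q -> nat -> R) (idx : 'I_q -> nat) (y : 'rV[R]_q)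
  : 'rV[R]_q := \row_k uki (xs k) (idx k) (y 0 k).
Definition u_inv q (xs : 'I_q -> nat -> R) (idx : 'I_q -> nat) (x : 'rV[R]_q)
  : 'rV[R]_q := \row_k uki_inv (xs k) (idx k) (x 0 k).

Definition amin q (M : 'I_q -> nat) (xs : 'I_q -> nat -> R) : R :=
  inf [set r | exists (k : 'I_q) (i : nat),
          (1 <= i <= M k)%N /\ r = `|acoef (xs k) i|].

Definition graph q (g : 'rV[R]_q -> R) : set 'rV[R]_(q + 1) :=
  [set row_mx x (const_mx (g x)) | x in @cube q].

Local Open Scope ereal_scope.

(** diameter (diam of the empty set is 0) *)
Definition diam n (A : set 'rV[R]_n) : \bar R :=
  ereal_sup ([set 0] `|` [set r | exists x y : 'rV[R]_n, A x /\ A y /\ r = (euclid (x - y))%:E]).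

Definition hcontent n (s delta : R) (F : set 'rV[R]_n) : \bar R :=
  ereal_inf [set \sum_(0 <= j <oo) ((fine (diam (U j))) `^ s)%R%:E
            | U in [set U : nat -> set 'rV[R]_n |
                    F `<=` \bigcup_j U j /\ forall j, diam (U j) <= delta%:E]].

(** s-dimensional Hausdorff measure H^s(F) = lim_{delta -> 0} H^s_delta(F)
    (a monotone limit, hence a supremum) *)
Definition hmeasure n (s : R) (F : set 'rV[R]_n) : \bar R :=
  ereal_sup [set hcontent s delta F | delta in [set d : R | (0 < d)%R]].

Definition dimH n (F : set 'rV[R]_n) : \bar R :=
  ereal_inf [set s%:E | s in [set s : R | (0 < s)%R /\ hmeasure s F = 0]].

Definition Ncover n (delta : R) (F : set 'rV[R]_n) : \bar R :=
  ereal_inf [set (m%:R)%:E | m in [set m : nat | exists U : 'I_m -> set 'rV[R]_n,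
               F `<=` \bigcup_(i in setT) U i /\ forall i, diam (U i) <= delta%:E]].

Definition lnE (x : \bar R) : \bar R :=
  match x with
  | r%:E => (ln r)%:E
  | +oo => +oo
  | -oo => -oo
  end.

Definition box_ratio n (F : set 'rV[R]_n) (delta : R) : \bar R :=
  lnE (Ncover delta F) * ((- ln delta)^-1)%:E.

Definition lower_box n (F : set 'rV[R]_n) : \bar R :=
  ereal_sup [set ereal_inf [set box_ratio F d | d in [set d : R | (0 < d < e)%R]]
            | e in [set e : R | (0 < e < 1)%R]].
Definition upper_box n (F : set 'rV[R]_n) : \bar R :=
  ereal_inf [set ereal_sup [set box_ratio F d | d in [set d : R | (0 < d < e)%R]]
            | e in [set e : R | (0 < e < 1)%R]].

End Defs.
Arguments cube {R} q.

(* Main.v *)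
(** Writing [g] for the fractal function and [a] for the smallest contraction ratio, the functional
    equation on one cell gives [|g x - g y| <= C t^sig + A |g x' - g y'|], where [t = |x - y|],
    [|x' - y'| <= t / a] and [A = sup |alpha| < a^sig].  Iterating this as long as the two points share
    a cell yields the Hölder bound, but cutting a segment at each cell interface would cost a factor
    at every step when [sig < 1].  This is avoided by moving one coordinate at a time: a pair that
    straddles an interface is cut there once, and the functional equation then sends the cutting
    point to a point whose moving coordinate is 0 or 1; short pairs with such an endpoint never
    straddle again.

    For [dim_H >= q], a cover of the graph with small [q]-dimensional content projects to a cover of
    the cube; compactness makes it finite, and counting the points of a fine grid in each piece
    replaces Lebesgue measure.  The upper bound comes from covering the graph over each cube of a
    grid of mesh [1/N] by a column of [O(N^(1 - sig))] cubes. *)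
Require Import Defs.
From HB Require Import structures.
From mathcomp Require Import all_boot all_order all_algebra.
From mathcomp Require Import all_classical all_reals all_analysis ring lra.
Import Order.TTheory GRing.Theory Num.Theory.
Import numFieldNormedType.Exports.
Local Open Scope classical_set_scope.
Local Open Scope ring_scope.
Set Implicit Arguments. Unset Strict Implicit. Unset Printing Implicit Defensive.

(** * Hölder functions on the cube *)

Section Holder.
Variable R : realType.
Implicit Types (q : nat) (a A B C L t sig : R).

Lemma exprn_lt a t : 0 < a < 1 -> 0 < t -> exists n : nat, a ^+ n < t.
Proof.
move=> /andP[a0 a1] t0.
have na : `|a| < 1 by rewrite ger0_norm // ltW.
have := @cvg_expr R a na => /cvgrPdist_lt /(_ _ t0) [n _ Hn].
exists n; have := Hn n (leqnn n).
by rewrite sub0r normrN ger0_norm // exprn_ge0 // ltW.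
Qed.

Lemma powR_le (x y r : R) : 0 <= r -> 0 <= x -> x <= y -> x `^ r <= y `^ r.
Proof.
move=> r0 x0 xy; apply: ge0_ler_powR => //; rewrite nnegrE //.
exact: le_trans xy.
Qed.

Lemma powR_div (x y r : R) : 0 <= x -> 0 <= y -> (x / y) `^ r = x `^ r / y `^ r.
Proof.
move=> x0 y0; rewrite powRM ?invr_ge0 //; congr (_ * _).
by rewrite -powR_inv1 // powRAC powR_inv1 // powR_ge0.
Qed.

(** Here [d] is the size of a pair and [D] the increment across it. A step enlarges [d] by at most
    1/a and multiplies [D] by [A] up to a cost with constant [C]. The inequality on C + A L / a^sig
    lets [L] survive a step, and the one on [B] settles sizes at least [a]. The first alternative of
    a step lets the iteration stop early. *)
Lemma self_similar_bound (T : Type) (G : T -> Prop) (d D : T -> R) a A B C L sig :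
  0 < a < 1 -> 0 < sig -> 0 <= A -> 0 <= C -> 0 <= L ->
  C + A * L / a `^ sig <= L -> B <= L * a `^ sig ->
  (forall p, G p -> 0 <= d p) ->
  (forall p, G p -> D p <= B) ->
  (forall p, G p -> d p < a -> D p <= L * d p `^ sig \/
     exists p', [/\ G p', d p' <= d p / a & D p <= C * d p `^ sig + A * D p']) ->
  forall p, G p -> 0 < d p -> D p <= L * d p `^ sig.
Proof.
move=> a01 sig0 A0 C0 L0 CAL BL d0 DB step.
have [a0 a1] := andP a01.
(* The bound is stated for any [t] above [d p], since [d p'] may be far below [d p / a] and even
   vanish. The lower bound [a ^+ n <= t] does pass to [t / a] with [n] lowered by one. *)
have main : forall (n : nat) p t, G p -> d p <= t -> a ^+ n <= t ->
    D p <= L * t `^ sig.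
  elim=> [|n IH] p t Gp dt ant; last first.
    have [ta|at_] := ltP t a.
      have [Dp|[p' [Gp' dp' Dp]]] := step p Gp (le_lt_trans dt ta).
        by apply: (le_trans Dp); rewrite ler_wpM2l // powR_le ?d0 // ltW.
      have t0 : 0 <= t by rewrite (le_trans _ dt) ?d0.
      have : D p' <= L * (t / a) `^ sig.
        apply: IH => //; first by apply: (le_trans dp'); rewrite ler_wpM2r // invr_ge0 ltW.
        by rewrite ler_pdivlMr // -exprSr.
      rewrite powR_div // ?(ltW a0) // => Dp'.
      apply: (le_trans Dp).
      apply: (@le_trans _ _ (C * t `^ sig + A * (L * (t `^ sig / a `^ sig)))).
        by apply: lerD; rewrite ler_wpM2l // powR_le ?d0 // ltW.
      have -> : C * t `^ sig + A * (L * (t `^ sig / a `^ sig)) =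
                (C + A * L / a `^ sig) * t `^ sig by ring.
      by rewrite ler_wpM2r // powR_ge0.
    apply: (le_trans (DB p Gp)); apply: (le_trans BL).
    by rewrite ler_wpM2l // powR_le // ltW.
  apply: (le_trans (DB p Gp)); apply: (le_trans BL).
  rewrite ler_wpM2l //; apply: powR_le; [exact: ltW|exact: ltW|].
  by apply: (le_trans (ltW a1)); rewrite -(expr0 a).
move=> p Gp dp0; have [n hn] := exprn_lt a01 dp0.
exact: main Gp (lexx _) (ltW hn).
Qed.

Lemma euclid_ge0 n (v : 'rV[R]_n) : 0 <= euclid v.
Proof. exact: sqrtr_ge0. Qed.

Lemma coord_le_euclid n (v : 'rV[R]_n) k : `|v 0 k| <= euclid v.
Proof.
rewrite -sqrtr_sqr /euclid ler_sqrt; last by apply: sumr_ge0 => i _; exact: sqr_ge0.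
rewrite (bigD1 k) //= lerDl; apply: sumr_ge0 => i _; exact: sqr_ge0.
Qed.

Lemma euclid_le_coord n (v : 'rV[R]_n) c : 0 <= c ->
  (forall k, `|v 0 k| <= c) -> euclid v <= Num.sqrt n%:R * c.
Proof.
move=> c0 vc; rewrite /euclid -[c in _ * c](ger0_norm c0) -sqrtr_sqr -sqrtrM ?ler0n //.
rewrite ler_sqrt; last by rewrite mulr_ge0 ?ler0n // sqr_ge0.
apply: (@le_trans _ _ (\sum_(i < n) c ^+ 2)).
  apply: ler_sum => i _; rewrite -real_normK ?num_real //.
  by rewrite ler_pXn2r // ?nnegrE.
by rewrite sumr_const card_ord mulr_natl.
Qed.

Lemma euclid_single n (v : 'rV[R]_n) k :
  (forall l, l != k -> v 0 l = 0) -> euclid v = `|v 0 k|.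
Proof.
move=> v0; rewrite /euclid (bigD1 k) //= big1 ?addr0 ?sqrtr_sqr // => i ik.
by rewrite v0 // expr0n.
Qed.

Lemma holder_ex_ge0 q sig (h : 'rV[R]_q -> R) : holder_on sig h ->
  exists2 K : R, 0 <= K & forall x y, cube q x -> cube q y ->
    `|h x - h y| <= K * (euclid (x - y)) `^ sig.
Proof.
case=> K HK; exists `|K| => // x y cx cy; apply: le_trans (HK x y cx cy) _.
by rewrite ler_wpM2r ?powR_ge0 // ler_norm.
Qed.

Lemma cube_compact q : compact (cube q : set 'rV[R]_q).
Proof.
have := @rV_compact R q (fun=> `[0, 1]%classic) (fun=> @segment_compact R 0 1).
congr (compact _); rewrite eqEsubset; split => x /= Hx k; have := Hx k;
  by rewrite ?in_itv.
Qed.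

Lemma continuous_cube_bounded q (h : 'rV[R]_q -> R) :
  {within cube q, continuous h} -> exists2 B : R, 0 <= B & forall x, cube q x -> `|h x| <= B.
Proof.
move=> hc; have := compact_bounded (continuous_compact hc (@cube_compact q)).
case=> B0 [_ HB]; exists `|B0 + 1|; first exact: normr_ge0.
move=> x cx; apply: le_trans (ler_norm (B0 + 1)); apply: HB; first by rewrite ltrDl.
by exists x.
Qed.

Lemma holder_cube_bounded q sig (h : 'rV[R]_q -> R) : 0 < sig -> holder_on sig h ->
  exists2 B : R, 0 <= B & forall x, cube q x -> `|h x| <= B.
Proof.
move=> sig0 /holder_ex_ge0[K K0 HK].
exists (`|h 0| + K * (Num.sqrt q%:R * 1) `^ sig).
  by rewrite addr_ge0 // mulr_ge0 // powR_ge0.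
have c0 : cube q (0 : 'rV[R]_q) by move=> k; rewrite mxE lexx ler01.
move=> x cx; rewrite -[h x](subrK (h 0)) addrC.
apply: le_trans (ler_normD _ _) _; rewrite lerD2l.
apply: le_trans (HK x 0 cx c0) _; rewrite ler_wpM2l //.
apply: powR_le; [exact: ltW|exact: euclid_ge0|].
apply: euclid_le_coord => // k; rewrite subr0.
by have /andP[x0 x1] := cx k; rewrite ger0_norm.
Qed.

(** [sup] has a default value on unbounded sets, so a bound [B] is supplied before the supremum can
    dominate the values. *)
Lemma supnorm_ge q (h : 'rV[R]_q -> R) B x : (forall x, cube q x -> `|h x| <= B) ->
  cube q x -> `|h x| <= supnorm h.
Proof.
move=> HB cx; apply: ub_le_sup; last by exists x.
by exists B => _ [y cy <-]; exact: HB.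
Qed.

(* Changing the coordinates one at a time. *)
Lemma holder_of_coordinates q sig L (h : 'rV[R]_q -> R) : 0 < sig -> 0 <= L ->
  (forall k x y, cube q x -> cube q y -> (forall l, l != k -> x 0 l = y 0 l) ->
     `|h x - h y| <= L * `|x 0 k - y 0 k| `^ sig) ->
  holder_on sig h.
Proof.
move=> sig0 L0 Hk; exists (q%:R * L) => x y cx cy.
(* [z j] takes its first [j] coordinates from [y] and the rest from [x], so [z j] and [z j.+1]
   differ at most in coordinate [j]. *)
pose z (j : nat) : 'rV[R]_q := \row_k (if (k < j)%N then y 0 k else x 0 k).
have cz j : cube q (z j).
  by move=> k; rewrite mxE; case: ifP => _; [exact: cy|exact: cx].
have main j : (j <= q)%N -> `|h x - h (z j)| <= j%:R * (L * euclid (x - y) `^ sig).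
  elim: j => [_|j IH jq].
    have -> : z 0%N = x by apply/rowP => k; rewrite mxE ltn0.
    by rewrite subrr normr0 mul0r.
  apply: le_trans (ler_distD (h (z j)) _ _) _.
  rewrite -natr1 mulrDl mul1r; apply: lerD; first by apply: IH; exact: ltnW.
  apply: le_trans (Hk (Ordinal jq) _ _ (cz j) (cz j.+1) _) _.
    move=> l lj; rewrite !mxE ltnS [(l <= j)%N]leq_eqVlt.
    by have /negbTE -> : (l != j :> nat) by apply: contra lj => /eqP e; apply/eqP/val_inj.
  rewrite ler_wpM2l // powR_le ?(ltW sig0) //.
  by rewrite !mxE /= ltnn ltnSn; have := coord_le_euclid (x - y) (Ordinal jq); rewrite !mxE.
have := main q (leqnn q).
have -> : z q = y by apply/rowP => k; rewrite mxE ltn_ord.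
by rewrite mulrA.
Qed.
End Holder.

(** * Hölder continuity of the fractal function *)

Section Partition.
Variables (R : realType) (m : nat) (x : nat -> R).
Hypotheses (m2 : (2 <= m)%N) (x0 : x 0%N = 0) (xm : x m = 1).
Hypothesis xinc : forall i, (i < m)%N -> x i < x i.+1.

Lemma partition_cell v : 0 <= v <= 1 ->
  exists i, (1 <= i <= m)%N /\ x i.-1 <= v <= x i.
Proof.
move=> /andP[v0 v1].
have : forall j, (j < m)%N -> v <= x j.+1 ->
    exists i, (1 <= i <= m)%N /\ x i.-1 <= v <= x i.
  elim=> [|j IH] jm vj; first by exists 1%N; rewrite jm /= x0 v0 vj.
  have [vj'|/ltW vj'] := leP v (x j.+1); first exact: IH (ltnW jm) vj'.
  by exists j.+2; rewrite jm /= vj' vj.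
move=> /(_ m.-1); rewrite prednK; last exact: ltnW.
by rewrite xm; apply.
Qed.

Lemma partition_lt i : (1 <= i <= m)%N -> x i.-1 < x i.
Proof. by case: i => // i /= im; exact: xinc. Qed.

Lemma partition_itv i : (i <= m)%N -> 0 <= x i <= 1.
Proof.
have le_x : forall i j, (i + j <= m)%N -> x i <= x (i + j).
  move=> k; elim=> [|j IH]; first by rewrite addn0.
  rewrite addnS => kj; apply: le_trans (IH (ltnW kj)) _; exact/ltW/xinc.
move=> im; rewrite -x0 -xm; apply/andP; split; first exact: (le_x 0%N i).
by have := le_x i (m - i)%N; rewrite subnKC //; apply.
Qed.

Lemma norm_acoef i : (1 <= i <= m)%N -> `|acoef x i| = x i - x i.-1.
Proof.
move=> im; have xi := partition_lt im; rewrite /acoef; case: odd.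
  by rewrite ger0_norm // subr_ge0 ltW.
by rewrite distrC ger0_norm // subr_ge0 ltW.
Qed.

Lemma norm_acoef_gt0 i : (1 <= i <= m)%N -> 0 < `|acoef x i|.
Proof. by move=> im; rewrite norm_acoef // subr_gt0 partition_lt. Qed.

(** With at least two cells the first one ends strictly before 1; this makes the smallest ratio a
    strict contraction. *)
Lemma norm_acoef1_lt1 : `|acoef x 1| < 1.
Proof.
rewrite norm_acoef /= ?(ltnW m2) // x0 subr0.
have H : forall j, (j < m.-1)%N -> x 1%N < x j.+2.
  elim=> [|j IH] jm; first by apply: xinc.
  apply: lt_trans (IH (ltnW jm)) _; apply: xinc.
  by move: jm; rewrite -ltnS prednK // (leq_trans _ m2).
rewrite -xm; have := H m.-2; rewrite !prednK ?leqnn //; first by apply.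
- exact: ltnW.
- by rewrite -ltnS prednK // ltnW.
Qed.

Lemma dist_uki_inv i v w :
  `|uki_inv x i v - uki_inv x i w| = `|v - w| / `|acoef x i|.
Proof. by rewrite /uki_inv -mulrBl normrM normfV; congr (`|_| / _); ring. Qed.

Lemma uki_inv_itv i v : (1 <= i <= m)%N -> x i.-1 <= v <= x i ->
  0 <= uki_inv x i v <= 1.
Proof.
move=> im /andP[v0 v1]; have xi := partition_lt im.
rewrite /uki_inv /acoef /bcoef; case: odd.
  rewrite ler_pdivrMr ?subr_gt0 // mul1r lerD2r v1 andbT.
  by rewrite divr_ge0 // subr_ge0 // ltW.
rewrite -[x i.-1 - _]opprB invrN mulrN -mulNr opprB.
rewrite ler_pdivrMr ?subr_gt0 // mul1r divr_ge0 ?subr_ge0 //= ?(ltW xi) //.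
by rewrite lerD2l lerN2.
Qed.

(** Either orientation of a branch matches ends with ends. Hence a cut made on a cell face lands on
    a face of the whole cube after one inverse step. *)
Lemma uki_inv_end i v : (1 <= i <= m)%N -> v = x i.-1 \/ v = x i ->
  uki_inv x i v = 0 \/ uki_inv x i v = 1.
Proof.
move=> im; have xi := partition_lt im.
rewrite /uki_inv /acoef /bcoef; case: odd => -[] ->.
- by left; rewrite subrr mul0r.
- by right; rewrite divff // subr_eq0 gt_eqF.
- by right; rewrite divff // subr_eq0 lt_eqF.
- by left; rewrite subrr mul0r.
Qed.
End Partition.

(** * The smallest contraction ratio *)

Section Amin.
Variables (R : realType) (q : nat) (M : 'I_q -> nat) (xs : 'I_q -> nat -> R).
Hypotheses (q0 : (0 < q)%N) (hM : forall k, (2 <= M k)%N).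
Hypotheses (hx0 : forall k, xs k 0%N = 0) (hxM : forall k, xs k (M k) = 1).
Hypothesis hxinc : forall k (i : nat), (i < M k)%N -> xs k i < xs k i.+1.

Lemma amin_le k i : (1 <= i <= M k)%N -> amin M xs <= `|acoef (xs k) i|.
Proof.
move=> im; apply: ge_inf; last by exists k, i.
by exists 0 => _ [l [j [_ ->]]].
Qed.

Lemma amin_gt0 : 0 < amin M xs.
Proof.
(* A minimum over the finitely many cells, capped at 1, supplies a positive lower bound for the set
   whose infimum is taken; [i.+1] matches the numbering of cells from 1. *)
pose c := \big[Num.min/1]_(k < q) \big[Num.min/1]_(i < M k) `|acoef (xs k) i.+1|.
have c0 : 0 < c.
  apply: lt_bigmin => // k _; apply: lt_bigmin => // i _.
  by apply: (norm_acoef_gt0 (@hxinc k)); rewrite ltn_ord.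
apply: (lt_le_trans c0); apply: lb_le_inf.
  by exists `|acoef (xs (Ordinal q0)) 1|, (Ordinal q0), 1%N; rewrite (ltnW (hM _)).
move=> _ [k [[|i] [// /= im ->]]].
apply: le_trans (bigmin_le _ k _) _; exact: (bigmin_le _ (Ordinal im)).
Qed.

Lemma amin_lt1 : amin M xs < 1.
Proof.
apply: le_lt_trans (@amin_le (Ordinal q0) 1 _) _; first by rewrite (ltnW (hM _)).
exact: norm_acoef1_lt1 (hM _) (hx0 _) (hxM _) (@hxinc _).
Qed.
End Amin.

(** * Hölder bound for bounded solutions of the functional equation *)

Section FractalHolder.
Variables (R : realType) (q : nat) (M : 'I_q -> nat) (xs : 'I_q -> nat -> R).
Hypotheses (q0 : (0 < q)%N) (hM : forall k, (2 <= M k)%N).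
Hypotheses (hx0 : forall k, xs k 0%N = 0) (hxM : forall k, xs k (M k) = 1).
Hypothesis hxinc : forall k (i : nat), (i < M k)%N -> xs k i < xs k i.+1.
Let a := amin M xs.

Definition valid_index (idx : 'I_q -> nat) := forall k, (1 <= idx k <= M k)%N.
Definition in_cell (idx : 'I_q -> nat) (x : 'rV[R]_q) :=
  forall k, xs k (idx k).-1 <= x 0 k <= xs k (idx k).
Definition agree_off (k : 'I_q) (x y : 'rV[R]_q) := forall l, l != k -> x 0 l = y 0 l.
Definition on_face (idx : 'I_q -> nat) (k : 'I_q) (x : 'rV[R]_q) :=
  x 0 k = xs k (idx k).-1 \/ x 0 k = xs k (idx k).

Let a0 : 0 < a. Proof. exact: amin_gt0. Qed.
Let a1 : a < 1. Proof. exact: amin_lt1. Qed.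

Lemma cell_ex x : cube q x -> exists2 idx, valid_index idx & in_cell idx x.
Proof.
move=> cx; have /choice[idx Hidx] k := partition_cell (hM k) (hx0 k) (hxM k) (cx k).
by exists idx => k; have [] := Hidx k.
Qed.

Lemma amin_le_step k i : (1 <= i <= M k)%N -> a <= xs k i - xs k i.-1.
Proof. by move=> im; rewrite -(norm_acoef (@hxinc k)) //; exact: amin_le. Qed.

Lemma agree_eq k x y : agree_off k x y -> x 0 k = y 0 k -> x = y.
Proof.
by move=> xy xyk; apply/rowP => l; have [->//|lk] := eqVneq l k; exact: xy.
Qed.

(** Every cell has width at least [a], so a segment shorter than [a] in direction [k] can leave its
    starting cell only into the adjacent one. [P] is then the crossing point, on a face of both
    cells. *)
Lemma cell_pair k x y : cube q x -> cube q y -> agree_off k x y ->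
  `|x 0 k - y 0 k| < a ->
  (exists2 idx, valid_index idx & in_cell idx x /\ in_cell idx y) \/
  (exists P idx1 idx2,
     [/\ cube q P, agree_off k x P & agree_off k P y] /\
     [/\ valid_index idx1, in_cell idx1 x, in_cell idx1 P & on_face idx1 k P] /\
     [/\ valid_index idx2, in_cell idx2 P, in_cell idx2 y & on_face idx2 k P] /\
     `|x 0 k - P 0 k| <= `|x 0 k - y 0 k| /\ `|P 0 k - y 0 k| <= `|x 0 k - y 0 k|).
Proof.
(* The conclusion is symmetric once the two halves and the two cells are interchanged. *)
wlog xy : x y / x 0 k <= y 0 k.
  move=> H cx cy axy xya; have [xy|/ltW yx] := leP (x 0 k) (y 0 k); first exact: H.
  have ayx : agree_off k y x by move=> l lk; rewrite axy.
  have yxa : `|y 0 k - x 0 k| < a by rewrite distrC.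
  have [[idx vi [iy ix]]|] := H y x yx cy cx ayx yxa; first by left; exists idx.
  move=> [P [i1 [i2 [[cP yP Px] [[v1 c1 c1' o1] [[v2 c2 c2' o2] [d1 d2]]]]]]].
  right; exists P, i2, i1; split; [split=> //|split; [by split|split; [by split|]]].
  - by move=> l lk; rewrite Px.
  - by move=> l lk; rewrite yP.
  by rewrite [`|x 0 k - P 0 k|]distrC [`|P 0 k - y 0 k|]distrC [`|x 0 k - _|]distrC.
move=> cx cy axy; rewrite distrC ger0_norm ?subr_ge0 // => xya.
have [idx vi ix] := cell_ex cx.
have /andP[xl xr] := ix k.
have /andP[y0 y1] := cy k; have /andP[x0 x1] := cx k.
have [yr|yr] := leP (y 0 k) (xs k (idx k)).
  left; exists idx => //; split => // l; have [->|lk] := eqVneq l k.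
    by rewrite (le_trans xl) //=.
  by rewrite -axy // ix.
have iM : (idx k < M k)%N.
  have /andP[_] := vi k; rewrite leq_eqVlt => /orP[/eqP e|//].
  by move: yr; rewrite e hxM ltNge y1.
(* [P] slides [x] in direction [k] to the right end of its cell, and [idx2] is the next cell in that
   direction. *)
pose P : 'rV[R]_q := \row_l (if l == k then xs k (idx k) else x 0 l).
pose idx2 l := if l == k then (idx k).+1 else idx l.
have Pk : P 0 k = xs k (idx k) by rewrite mxE eqxx.
have Pl l : l != k -> P 0 l = x 0 l by move=> /negbTE lk; rewrite mxE lk.
have vi2 : valid_index idx2.
  by move=> l; rewrite /idx2; case: eqVneq => [->|_] //=; exact: vi.
(* The width of the next cell keeps [y] from passing beyond it. *)
have step := @amin_le_step k (idx k).+1 iM.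
have xk := partition_lt (@hxinc k) (vi k).
right; exists P, idx, idx2; split; [split|split; [split|split; [split|split]]] => //.
- move=> l; have [->|lk] := eqVneq l k; last by rewrite Pl.
  rewrite Pk; apply/andP; split; first exact: le_trans x0 xr.
  exact: le_trans (ltW yr) y1.
- by move=> l lk; rewrite Pl.
- by move=> l lk; rewrite Pl // axy.
- move=> l; have [->|lk] := eqVneq l k; last by rewrite Pl.
  by rewrite Pk lexx ltW.
- by right.
- move=> l; rewrite /idx2; case: eqVneq => [->|lk] /=; last by rewrite Pl.
  by rewrite Pk lexx ltW // hxinc.
- move=> l; rewrite /idx2; case: eqVneq => [->|lk] /=; last by rewrite -axy.
  rewrite (ltW yr) /=; move: step xya xr => /=; lra.
- by left; rewrite /idx2 eqxx.
- by rewrite Pk distrC !ger0_norm ?subr_ge0 // 1?distrC ?ger0_norm ?subr_ge0 // lerD2r ltW.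
- by rewrite Pk distrC !ger0_norm ?subr_ge0 // ?(ltW yr) // 1?distrC ?ger0_norm ?subr_ge0 // lerD2l lerN2.
Qed.

(** All partition points lie in [0, 1], so a cell can reach 0 or 1 only at one of its ends. *)
Lemma end_face k idx x : valid_index idx -> in_cell idx x ->
  x 0 k = 0 \/ x 0 k = 1 -> on_face idx k x.
Proof.
move=> vi ix; have /andP[xl xr] := ix k; have /andP[i1 iM] := vi k.
have itv := partition_itv (hx0 k) (hxM k) (@hxinc k).
have /andP[l0 _] := itv (idx k).-1 (leq_trans (leq_pred _) iM).
have /andP[_ r1] := itv _ iM.
by case=> xe; [left|right]; apply/eqP; rewrite eq_le; apply/andP; split => //;
  rewrite xe.
Qed.

(** The two faces of a cell in direction [k] are at least [a] apart, so closer points lie on the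
    same one. *)
Lemma face_eq k idx x y : valid_index idx -> on_face idx k x -> on_face idx k y ->
  `|x 0 k - y 0 k| < a -> x 0 k = y 0 k.
Proof.
move=> vi; have H := amin_le_step (vi k).
have K : xs k (idx k) - xs k (idx k).-1 <= `|xs k (idx k) - xs k (idx k).-1| := ler_norm _.
case=> -> [] -> //; [rewrite distrC|] => Ka; suff: a < a by rewrite ltxx.
  exact: le_lt_trans H (le_lt_trans K Ka).
exact: le_lt_trans H (le_lt_trans K Ka).
Qed.

Variables (sig : R) (f alpha s g : 'rV[R]_q -> R).
Hypothesis sig0 : 0 < sig.
Variables (Kf Ka Ks Bg Bs A : R).
Hypotheses (Kf0 : 0 <= Kf) (Ka0 : 0 <= Ka) (Ks0 : 0 <= Ks).
Hypotheses (Bg0 : 0 <= Bg) (Bs0 : 0 <= Bs) (A0 : 0 <= A).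
Hypothesis hf : forall x y, cube q x -> cube q y -> `|f x - f y| <= Kf * euclid (x - y) `^ sig.
Hypothesis ha : forall x y, cube q x -> cube q y ->
  `|alpha x - alpha y| <= Ka * euclid (x - y) `^ sig.
Hypothesis hs : forall x y, cube q x -> cube q y -> `|s x - s y| <= Ks * euclid (x - y) `^ sig.
Hypothesis hBg : forall x, cube q x -> `|g x| <= Bg.
Hypothesis hBs : forall x, cube q x -> `|s x| <= Bs.
Hypothesis hA : forall x, cube q x -> `|alpha x| <= A.
Hypothesis hAa : A / a `^ sig < 1.
Hypothesis hfe : forall idx, valid_index idx -> forall x, in_cell idx x ->
  g x = f x + alpha x * (g (u_inv xs idx x) - s (u_inv xs idx x)).

Lemma euclid_agree k x y : agree_off k x y -> euclid (x - y) = `|x 0 k - y 0 k|.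
Proof.
by move=> xy; rewrite (@euclid_single _ _ _ k) ?mxE // => l lk; rewrite !mxE xy ?subrr.
Qed.

(** The cost of one use of the functional equation: increments of [f], of [alpha] against the
    bounded factor [g - s], and of [s] at points spread apart by at most 1/a. *)
Let C := Kf + Ka * (Bg + Bs) + A * Ks / a `^ sig.
(** The first summand solves L = C + A L / a^sig; the second makes L a^sig at least [2 * Bg], the
    trivial bound on increments of [g]. *)
Let L := C / (1 - A / a `^ sig) + 2 * Bg / a `^ sig.

Let as0 : 0 < a `^ sig. Proof. exact: powR_gt0. Qed.
Let C0 : 0 <= C.
Proof.
apply: addr_ge0; last by rewrite !mulr_ge0 // invr_ge0 ltW.
by apply: addr_ge0 => //; apply: mulr_ge0 => //; exact: addr_ge0.
Qed.
Let BL : 2 * Bg <= L * a `^ sig.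
Proof.
rewrite /L [leRHS]mulrDl [2 * Bg / _ * _]divfK ?gt_eqF // lerDr mulr_ge0 // ?(ltW as0) //.
by rewrite divr_ge0 // subr_ge0 ltW.
Qed.
Let L0 : 0 <= L.
Proof.
have : 0 <= L * a `^ sig by apply: le_trans BL; rewrite mulr_ge0.
by rewrite pmulr_lge0.
Qed.
Let CAL : C + A * L / a `^ sig <= L.
Proof.
have -> : C + A * L / a `^ sig = C + L - (1 - A / a `^ sig) * L by ring.
have r0 : 0 < 1 - A / a `^ sig by rewrite subr_gt0.
rewrite lerBlDr [leRHS]addrC lerD2r /L mulrDr [_ * (C / _)]mulrC divfK ?gt_eqF // lerDl.
by apply: mulr_ge0; [exact: ltW|rewrite divr_ge0 // ?mulr_ge0 // ltW].
Qed.

Lemma diff_le2 x y : cube q x -> cube q y -> `|g x - g y| <= 2 * Bg.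
Proof.
move=> cx cy; apply: le_trans (ler_normB _ _) _.
by rewrite mulr_natl mulr2n lerD // hBg.
Qed.

Lemma u_inv_cube idx x : valid_index idx -> in_cell idx x -> cube q (u_inv xs idx x).
Proof. by move=> vi ix k; rewrite mxE; exact: (uki_inv_itv (@hxinc k)). Qed.

Lemma u_inv_agree k idx x y : agree_off k x y ->
  agree_off k (u_inv xs idx x) (u_inv xs idx y).
Proof. by move=> xy l lk; rewrite !mxE xy. Qed.

Lemma u_inv_dist k idx x y : valid_index idx ->
  `|u_inv xs idx x 0 k - u_inv xs idx y 0 k| <= `|x 0 k - y 0 k| / a.
Proof.
move=> vi; rewrite !mxE dist_uki_inv ler_wpM2l // lef_pV2 ?posrE //.
- exact: amin_le.
- exact: norm_acoef_gt0 (@hxinc k) _ _.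
Qed.

Lemma cell_step k idx x y : cube q x -> cube q y -> valid_index idx ->
  in_cell idx x -> in_cell idx y -> agree_off k x y ->
  `|g x - g y| <= C * `|x 0 k - y 0 k| `^ sig
                  + A * `|g (u_inv xs idx x) - g (u_inv xs idx y)|.
Proof.
move=> cx cy vi ix iy xy; rewrite (hfe vi ix) (hfe vi iy).
set X := u_inv xs idx x; set Y := u_inv xs idx y.
have cX : cube q X by exact: u_inv_cube.
have cY : cube q Y by exact: u_inv_cube.
set d := `|x 0 k - y 0 k|.
(* Only the term with [g X - g Y] is left to the iteration; the other three are absorbed in [C]. *)
have -> : f x + alpha x * (g X - s X) - (f y + alpha y * (g Y - s Y)) =
  (f x - f y) + (alpha x - alpha y) * (g X - s X) +
  alpha y * (g X - g Y) - alpha y * (s X - s Y) by ring.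
have e := euclid_agree xy.
have e' : euclid (X - Y) = `|X 0 k - Y 0 k| := euclid_agree (u_inv_agree idx xy).
have H1 : `|f x - f y| <= Kf * d `^ sig by rewrite /d -e; exact: hf.
have H2 : `|(alpha x - alpha y) * (g X - s X)| <= Ka * d `^ sig * (Bg + Bs).
  rewrite normrM; apply: ler_pM => //; first by rewrite /d -e; exact: ha.
  by apply: le_trans (ler_normB _ _) _; apply: lerD; [exact: hBg|exact: hBs].
have H3 : `|alpha y * (g X - g Y)| <= A * `|g X - g Y|.
  by rewrite normrM; apply: ler_wpM2r => //; exact: hA.
have H4 : `|alpha y * (s X - s Y)| <= A * (Ks * (d `^ sig / a `^ sig)).
  rewrite normrM; apply: ler_pM => //; first exact: hA.
  apply: le_trans (hs cX cY) _; rewrite ler_wpM2l // -powR_div ?(ltW a0) ?normr_ge0 // e'.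
  by apply: powR_le; [exact: ltW|exact: normr_ge0|exact: u_inv_dist].
apply: le_trans (ler_normB _ _) _.
apply: le_trans (lerD (ler_normD _ _) (lexx _)) _.
apply: le_trans (lerD (lerD (ler_normD _ _) (lexx _)) (lexx _)) _.
apply: le_trans (lerD (lerD (lerD H1 H2) H3) H4) _.
by rewrite le_eqVlt; apply/orP; left; apply/eqP; rewrite /C; ring.
Qed.

(* If one endpoint of the pair has its varying coordinate in {0, 1}, a short pair never straddles
   two cells, so the self-similarity can be iterated without splitting. *)
Lemma end_bound k x y : cube q x -> cube q y -> agree_off k x y ->
  x 0 k = 0 \/ x 0 k = 1 -> `|g x - g y| <= L * `|x 0 k - y 0 k| `^ sig.
Proof.
move=> cx cy xy xe.
have [e|ne] := eqVneq (x 0 k) (y 0 k).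
  by rewrite (agree_eq xy e) subrr normr0 mulr_ge0 // powR_ge0.
(* The end condition on the first point is an invariant: such a point lies on a face of its cell and
   is sent to coordinate 0 or 1 again. *)
pose G (p : 'rV[R]_q * 'rV[R]_q) :=
  [/\ cube q p.1, cube q p.2, agree_off k p.1 p.2 & p.1 0 k = 0 \/ p.1 0 k = 1].
pose d (p : 'rV[R]_q * 'rV[R]_q) := `|p.1 0 k - p.2 0 k|.
pose D (p : 'rV[R]_q * 'rV[R]_q) := `|g p.1 - g p.2|.
have a01 : 0 < a < 1 by rewrite a0 a1.
apply: (@self_similar_bound R _ G d D a A _ C L sig a01 sig0 A0 C0 L0 CAL BL _ _ _ (x, y)) => //.
- by move=> p _; exact: normr_ge0.
- by move=> p [? ? _ _]; exact: diff_le2.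
- move=> {cx cy xy xe ne} [{}x {}y] [/= cx cy xy xe] dxy; right.
  have [idx [vi ix iy xf]] : exists idx, [/\ valid_index idx, in_cell idx x,
      in_cell idx y & on_face idx k x].
    have [[idx vi [ix iy]]|] := cell_pair cx cy xy dxy.
      by exists idx; split=> //; exact: end_face.
    move=> [P [i1 [i2 [[cP xP Py] [[v1 x1 P1 o1] [[v2 P2 y2 o2] [d1 _]]]]]]].
    (* [x] and [P] lie on faces of the same cell [i1] at distance below [a], so they coincide and
       [i2] contains the whole pair. *)
    have e : x = P.
      apply: (agree_eq xP); apply: (face_eq v1 _ o1); first exact: end_face.
      exact: le_lt_trans d1 dxy.
    by exists i2; split=> //; rewrite e.
  exists (u_inv xs idx x, u_inv xs idx y); split; last exact: cell_step.
  - split=> /=; [exact: u_inv_cube|exact: u_inv_cube|exact: u_inv_agree|].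
    by rewrite mxE; exact: (uki_inv_end (@hxinc k)).
  - exact: u_inv_dist.
- by rewrite normr_gt0 subr_eq0.
Qed.

(** One inverse step moves the face point to an end coordinate, where [end_bound] applies; [CAL]
    absorbs the step without enlarging [L]. *)
Lemma face_bound k idx x y : cube q x -> cube q y -> agree_off k x y ->
  valid_index idx -> in_cell idx x -> in_cell idx y -> on_face idx k x ->
  `|g x - g y| <= L * `|x 0 k - y 0 k| `^ sig.
Proof.
move=> cx cy xy vi ix iy xf; set d := `|x 0 k - y 0 k|.
have := cell_step cx cy vi ix iy xy; rewrite -/d => H; apply: (le_trans H).
have E : `|g (u_inv xs idx x) - g (u_inv xs idx y)| <= L * (d `^ sig / a `^ sig).
  have := @end_bound k (u_inv xs idx x) (u_inv xs idx y).
  move=> /(_ (u_inv_cube vi ix) (u_inv_cube vi iy) (u_inv_agree idx xy)).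
  rewrite {1 2}mxE => /(_ (uki_inv_end (@hxinc k) (vi k) xf)) /le_trans; apply.
  rewrite ler_wpM2l // -powR_div ?(ltW a0) ?normr_ge0 //.
  by apply: powR_le; [exact: ltW|exact: normr_ge0|exact: u_inv_dist].
apply: (@le_trans _ _ (C * d `^ sig + A * (L * (d `^ sig / a `^ sig)))).
  by rewrite lerD2l ler_wpM2l.
have -> : C * d `^ sig + A * (L * (d `^ sig / a `^ sig)) =
          (C + A * L / a `^ sig) * d `^ sig by ring.
by rewrite ler_wpM2r // powR_ge0.
Qed.

(** A pair is expanded as long as it shares a cell. At the first straddling, each half has an
    endpoint on a face and costs one [L], and the iteration ends there, so the factor 2 is paid only
    once. *)
Lemma coordinate_bound k x y : cube q x -> cube q y -> agree_off k x y ->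
  `|g x - g y| <= 2 * L * `|x 0 k - y 0 k| `^ sig.
Proof.
move=> cx cy xy.
have [e|ne] := eqVneq (x 0 k) (y 0 k).
  by rewrite (agree_eq xy e) subrr normr0 mulr_ge0 ?powR_ge0 // mulr_ge0.
pose G (p : 'rV[R]_q * 'rV[R]_q) := [/\ cube q p.1, cube q p.2 & agree_off k p.1 p.2].
pose d (p : 'rV[R]_q * 'rV[R]_q) := `|p.1 0 k - p.2 0 k|.
pose D (p : 'rV[R]_q * 'rV[R]_q) := `|g p.1 - g p.2|.
have a01 : 0 < a < 1 by rewrite a0 a1.
have L20 : 0 <= 2 * L by rewrite mulr_ge0.
(* Doubling [L] keeps the inequality because [C] is nonnegative. *)
have CAL2 : C + A * (2 * L) / a `^ sig <= 2 * L.
  have -> : C + A * (2 * L) / a `^ sig = (C + A * L / a `^ sig) * 2 - C by ring.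
  by rewrite lerBlDr mulrC; apply: ler_wpDr => //; rewrite ler_wpM2l.
have BL2 : 2 * Bg <= 2 * L * a `^ sig.
  apply: (le_trans BL); rewrite -mulrA ler_peMl // ?mulr_ge0 ?(ltW as0) //.
  by rewrite ler1n.
apply: (@self_similar_bound R _ G d D a A _ C _ sig a01 sig0 A0 C0 L20 CAL2 BL2 _ _ _ (x, y)) => //.
- by move=> p _; exact: normr_ge0.
- by move=> p [? ? _]; exact: diff_le2.
- move=> {cx cy xy ne} [{}x {}y] [/= cx cy xy] dxy.
  have [[idx vi [ix iy]]|] := cell_pair cx cy xy dxy.
    right; exists (u_inv xs idx x, u_inv xs idx y).
    split; [|exact: u_inv_dist|exact: cell_step].
    by split=> /=; [exact: u_inv_cube|exact: u_inv_cube|exact: u_inv_agree].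
  move=> [P [i1 [i2 [[cP xP Py] [[v1 x1 P1 o1] [[v2 P2 y2 o2] [d1 d2]]]]]]].
  left; rewrite /D /d /=; apply: le_trans (ler_distD (g P) _ _) _.
  rewrite -mulrA mulr_natl mulr2n; apply: lerD.
    rewrite distrC; apply: le_trans (face_bound cP cx _ v1 P1 x1 o1) _.
      by move=> l lk; rewrite xP.
    by rewrite ler_wpM2l //; apply: powR_le; rewrite // 1?distrC // ltW.
  apply: le_trans (face_bound cP cy Py v2 P2 y2 o2) _.
  by rewrite ler_wpM2l //; apply: powR_le => //; exact: ltW.
- by rewrite normr_gt0 subr_eq0.
Qed.

Lemma self_affine_holder : holder_on sig g.
Proof.
apply: (holder_of_coordinates sig0 (L := 2 * L)); first by rewrite mulr_ge0.
exact: coordinate_bound.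
Qed.
End FractalHolder.

(** * Hausdorff and box dimensions *)

Section Dimension.
Variables (R : realType) (n : nat).
Implicit Types (F A : set 'rV[R]_n) (d t : R).
Local Open Scope ereal_scope.

Lemma diam_ge0 A : 0 <= diam A.
Proof. by apply: ereal_sup_ubound; left. Qed.

Lemma euclid_le_diam A x y : A x -> A y -> (euclid (x - y))%:E <= diam A.
Proof. by move=> Ax Ay; apply: ereal_sup_ubound; right; exists x, y. Qed.

Lemma diam_le A (c : R) : (0 <= c)%R ->
  (forall x y, A x -> A y -> (euclid (x - y) <= c)%R) -> diam A <= c%:E.
Proof.
move=> c0 Ac; apply: ge_ereal_sup => _ [->|[x [y [Ax [Ay ->]]]]].
  by rewrite lee_fin.
by rewrite lee_fin; exact: Ac.
Qed.

Lemma diam0 : diam (set0 : set 'rV[R]_n) = 0.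
Proof. by apply/eqP; rewrite eq_le diam_ge0 diam_le // => x y []. Qed.

Lemma fine_diam A d : diam A <= d%:E -> diam A = (fine (diam A))%:E /\ (0 <= fine (diam A) <= d)%R.
Proof.
have := diam_ge0 A; case: (diam A) => [r| |] //=.
by rewrite !lee_fin => -> ->.
Qed.

Lemma lower_le_upper_box F : lower_box F <= upper_box F.
Proof.
(* A scale below both thresholds competes in the infimum for [e] and in the supremum for [e']. *)
apply: ge_ereal_sup => _ [e /andP[e0 e1] <-].
apply: le_ereal_inf_tmp => _ [e' /andP[e'0 e'1] <-].
pose d := (Num.min e e' / 2)%R.
have m0 : (0 < Num.min e e')%R by rewrite lt_min e0 e'0.
have d0 : (0 < d)%R by rewrite divr_gt0.
have dm : (d < Num.min e e')%R by rewrite ltr_pdivrMr // ltr_pMr // ltr1n.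
move: (dm); rewrite lt_min => /andP[de de'].
apply: (@le_trans _ _ (box_ratio F d)).
  by apply: ereal_inf_lbound; exists d => //=; rewrite d0.
by apply: ereal_sup_ubound; exists d => //=; rewrite d0.
Qed.

Lemma Ncover_ge1 F d : F !=set0 -> 1 <= Ncover d F.
Proof.
move=> [x Fx]; apply: le_ereal_inf_tmp => _ [[|m] [U [FU _]] <-].
  by have [[]] := FU x Fx.
by rewrite lee_fin ler1n.
Qed.

Lemma inv_oppln_gt0 d : (0 < d < 1)%R -> (0 < (- ln d)^-1)%R.
Proof. by move=> d01; rewrite invr_gt0 oppr_gt0 ln_lt0. Qed.

Lemma box_ratio_ge0 F d : F !=set0 -> (0 < d < 1)%R -> 0 <= box_ratio F d.
Proof.
move=> F0 d01; apply: mule_ge0; last by rewrite lee_fin ltW // inv_oppln_gt0.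
by have := Ncover_ge1 d F0; case: Ncover => [r| |] //=; rewrite !lee_fin; exact: ln_ge0.
Qed.

Lemma lower_box_ge0 F : F !=set0 -> 0 <= lower_box F.
Proof.
move=> F0; apply: (@le_trans _ _ (ereal_inf [set box_ratio F d | d in [set d | (0 < d < 2^-1)%R]])).
  apply: le_ereal_inf_tmp => _ [d /andP[d0 d2] <-]; apply: box_ratio_ge0 => //.
  by rewrite d0 (lt_trans d2) // invf_lt1 // ltr1n.
by apply: ereal_sup_ubound; exists (2^-1)%R => //=; rewrite invr_gt0 ltr0n invf_lt1 // ltr1n.
Qed.

Lemma box_ratio_lt F d t : (0 < d < 1)%R -> box_ratio F d < t%:E ->
  Ncover d F < (d `^ (- t))%:E.
Proof.
move=> d01; have d0 := inv_oppln_gt0 d01; rewrite /box_ratio.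
case: (Ncover d F) => [r| |] /=; last by rewrite ltNyr.
  rewrite -EFinM !lte_fin ltr_pdivrMr; last by rewrite -invr_gt0.
  (* [ln] takes a default value at nonpositive arguments, so that case is settled by sign alone. *)
  move=> H; have [r0|r0] := ltP 0%R r; last first.
    by apply: (le_lt_trans r0); apply: powR_gt0; case/andP: d01.
  rewrite -ltr_ln ?posrE ?powR_gt0 //; last by case/andP: d01.
  by rewrite ln_powR mulNr -mulrN.
by rewrite gt0_mulye ?lte_fin // ltNge leey.
Qed.

Lemma hcontent_ge0 t d F : 0 <= hcontent t d F.
Proof.
apply: le_ereal_inf_tmp => _ [U _ <-]; apply: nneseries_ge0 => j _ _.
by rewrite lee_fin powR_ge0.
Qed.

Lemma hmeasure_eq0 t F :
  (forall d e, (0 < d)%R -> (0 < e)%R -> hcontent t d F <= e%:E) -> hmeasure t F = 0.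
Proof.
move=> H; apply/eqP; rewrite eq_le; apply/andP; split.
  apply: ge_ereal_sup => _ [d d0 <-]; apply/lee_addgt0Pr => e e0.
  by rewrite add0e; exact: H.
apply: le_trans (hcontent_ge0 t 1 F) _; apply: ereal_sup_ubound.
by exists 1%R => //=.
Qed.

Lemma hcontent_le_cover t d d' F m (U : 'I_m -> set 'rV[R]_n) : (0 < t)%R ->
  (0 <= d <= d')%R ->
  F `<=` \bigcup_(i in setT) U i -> (forall i, diam (U i) <= d%:E) ->
  hcontent t d' F <= (m%:R * d `^ t)%:E.
Proof.
move=> t0 /andP[d0 dd'] FU Ud.
(* The finite family is padded with empty sets, whose terms vanish because 0^t = 0 for positive
   [t]. *)
pose V (j : nat) := if insub j is Some i then U i else set0.
have Vd j : diam (V j) <= d%:E.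
  by rewrite /V; case: insubP => [i _ _|_]; [exact: Ud|rewrite diam0 lee_fin].
apply: (@le_trans _ _ (\sum_(0 <= j <oo) ((fine (diam (V j))) `^ t)%R%:E)).
  apply: ereal_inf_lbound; exists V => //; split; last first.
    by move=> j; apply: le_trans (Vd j) _; rewrite lee_fin.
  move=> x Fx; have [i _ Ui] := FU x Fx; exists (i : nat) => //.
  by rewrite /V valK.
rewrite (@nneseries_split _ _ 0%N m); last by move=> k _; rewrite lee_fin powR_ge0.
rewrite (@eseries0 _ _ (0 + m)%N); last first.
  move=> i mi _; rewrite /V insubF ?diam0 /= ?powR0 ?gt_eqF //.
  by apply: negbTE; rewrite -leqNgt.
rewrite adde0 add0n sumEFin lee_fin.
apply: (@le_trans _ _ (\sum_(0 <= j < m) d `^ t)%R).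
  apply: ler_sum => j _; have [_ /andP[a b]] := fine_diam (Vd j).
  by apply: powR_le => //; exact: ltW.
by rewrite sumr_const_nat subn0 mulr_natl.
Qed.

(** If the lower box dimension is [r], there are arbitrarily small scales [c] with covers by fewer
    than c^-(r + e/2) sets of diameter at most [c]; their contribution in dimension r + e is at most
    c^(e/2). *)
Lemma dimH_le_lower_box F : F !=set0 -> dimH F <= lower_box F.
Proof.
move=> F0; have := lower_box_ge0 F0.
case E : (lower_box F) => [r| |] // => [r0|_]; last exact: leey.
apply/lee_addgt0Pr => e e0; rewrite lee_fin in r0.
have re0 : (0 < r + e)%R by rewrite ltr_wpDl.
apply: ereal_inf_lbound; exists (r + e)%R => //; split => //.
apply: hmeasure_eq0 => d ep d0 ep0.
(* An exponent strictly between [r] and [r + e] leaves the factor c^(e/2) to spare. *)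
pose t' := (r + e / 2)%R.
have e20 : (0 < e / 2)%R by rewrite divr_gt0.
(* The three entries keep the scale below 1, admissible for [d], and small enough that c^(e/2) is at
   most [ep]. *)
pose e1 := (Num.min (2^-1) (Num.min d (ep `^ (e / 2)^-1)))%R.
have e10 : (0 < e1)%R by rewrite !lt_min invr_gt0 ltr0n d0 powR_gt0.
have e11 : (e1 < 1)%R by rewrite gt_min invf_lt1 // ltr1n.
have : ereal_inf [set box_ratio F d | d in [set d | (0 < d < e1)%R]] < t'%:E.
  apply: (@le_lt_trans _ _ r%:E); last by rewrite lte_fin ltrDl.
  by rewrite -E; apply: ereal_sup_ubound; exists e1 => //=; rewrite e10.
move=> /ereal_inf_lt[_ [c /andP[c0 ce1] <-]] cr.
have c01 : (0 < c < 1)%R by rewrite c0 (lt_trans ce1).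
have /ereal_inf_lt[_ [m [U [FU Uc]] <-]] := box_ratio_lt c01 cr.
rewrite lte_fin => mc.
move: ce1; rewrite !lt_min => /and3P[_ cd cep].
apply: le_trans (hcontent_le_cover (d := c) re0 _ FU Uc) _; first by rewrite !ltW.
rewrite lee_fin; apply: (@le_trans _ _ (c `^ (- t') * c `^ (r + e)))%R.
  by rewrite ler_wpM2r ?powR_ge0 // ltW.
rewrite -powRD; last by rewrite (gt_eqF c0) implybT.
have -> : (- t' + (r + e) = e / 2)%R by rewrite /t'; lra.
apply: (@le_trans _ _ ((ep `^ (e / 2)^-1) `^ (e / 2)))%R.
  by apply: powR_le; exact: ltW.
by rewrite -powRrM mulVf ?gt_eqF // powRr1 // ltW.
Qed.
End Dimension.

(** * Grid counting in the cube and the lower bound for the Hausdorff dimension of a graph *)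

Section CubeMass.
Variable R : realType.

(** From the least index [i0] in the set, every other one is at distance at most the integer part of
    [2 * r]. *)
Lemma card_ord_near (N : nat) (c r : R) : 0 < r ->
  (#|[pred i : 'I_N | `|i%:R - c| < r]|%:R <= 2 * r + 1 :> R).
Proof.
move=> r0; set S := [pred i : 'I_N | _].
have r2 : 0 <= 2 * r by rewrite mulr_ge0 // ltW.
case: (pickP S) => [i1 Si1|S0]; last by rewrite eq_card0 // addr_ge0.
case: (arg_minnP (fun i : 'I_N => i : nat) Si1) => i0 Si0 Hmin.
have Scard : (#|S| <= (Num.trunc (2 * r)).+1)%N.
  rewrite cardE -(size_map val) -[leqRHS](size_iota i0).
  apply: uniq_leq_size; first by rewrite map_inj_uniq ?enum_uniq //; exact: val_inj.
  move=> x /mapP[i]; rewrite mem_enum => Si ->{x}; have i0i := Hmin i Si.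
  rewrite mem_iota i0i /= addnS ltnS -leq_subLR truncn_ge_nat // natrB //.
  move: Si Si0; rewrite !inE !ltr_distl => /andP[_ h1] /andP[h2 _].
  by move: h1 h2; lra.
apply: (@le_trans _ _ ((Num.trunc (2 * r)).+1%:R)); first by rewrite ler_nat.
by rewrite -natr1 lerD2r truncn_le.
Qed.

(** On a grid of mesh 1/N, a piece of radius [rho] meets at most 2 rho N + 1 values in each
    coordinate, and this is at most 4 rho N once rho N is at least 1. All N^q grid points must be
    met. *)
Lemma cube_cover_mass q n (c : 'I_n -> 'rV[R]_q) (rho : 'I_n -> R) :
  (forall j, 0 < rho j) ->
  (forall x, cube q x -> exists j, forall k, `|x 0 k - c j 0 k| < rho j) ->
  1 <= \sum_(j < n) (4 * rho j) ^+ q.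
Proof.
move=> rho0 cov.
(* The sum exceeds every 1/rho j, so one mesh is fine enough for all pieces. *)
pose N := (\sum_(j < n) (Num.trunc (rho j)^-1).+1).+1.
have N0 : 0 < N%:R :> R by rewrite ltr0n.
have rN j : 1 <= rho j * N%:R.
  rewrite mulrC -ler_pdivrMr // div1r; apply: (le_trans (ltW (truncnS_gt _))).
  by rewrite ler_nat /N (bigD1 j) //= leqW // leq_addr.
pose pt (i : {ffun 'I_q -> 'I_N}) : 'rV[R]_q := \row_k ((i k)%:R / N%:R).
have cpt i : cube q (pt i).
  move=> k; rewrite mxE divr_ge0 ?ler0n //= ler_pdivrMr // mul1r ler_nat.
  exact/ltnW/ltn_ord.
pose near_ j (i : {ffun 'I_q -> 'I_N}) := [forall k, `|pt i 0 k - c j 0 k| < rho j].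
have card_near j : (#|near_ j|%:R <= (4 * rho j * N%:R) ^+ q :> R).
  (* Being near the centre is a separate condition on each coordinate, so the count is a product. *)
  pose Fk k := [pred i : 'I_N | `|i%:R - c j 0 k * N%:R| < rho j * N%:R].
  have -> : #|near_ j| = #|(family Fk : simpl_pred {ffun 'I_q -> 'I_N})|.
    apply: eq_card => i; apply/forallP/familyP => H k; have := H k;
      rewrite !inE !mxE.
      have -> : (i k)%:R - c j 0 k * N%:R = ((i k)%:R / N%:R - c j 0 k) * N%:R.
        by rewrite mulrBl divfK ?gt_eqF.
      by rewrite normrM (gtr0_norm N0) ltr_pM2r.
    have -> : (i k)%:R - c j 0 k * N%:R = ((i k)%:R / N%:R - c j 0 k) * N%:R.
      by rewrite mulrBl divfK ?gt_eqF.
    by rewrite normrM (gtr0_norm N0) ltr_pM2r.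
  rewrite card_family foldrE big_map big_enum /= natr_prod.
  apply: (@le_trans _ _ (\prod_(k < q) (4 * rho j * N%:R))); last first.
    by rewrite prodr_const card_ord.
  apply: ler_prod => k _; rewrite ler0n /=.
  apply: (le_trans (card_ord_near _ _ _)); first by rewrite mulr_gt0.
  by have := rN j; lra.
have tot : (N%:R ^+ q <= \sum_(j < n) (4 * rho j * N%:R) ^+ q :> R).
  apply: (@le_trans _ _ (\sum_(j < n) #|near_ j|%:R)); last by apply: ler_sum => j _.
  rewrite -natrX -natr_sum ler_nat.
  have -> : (N ^ q)%N = (\sum_(i : {ffun 'I_q -> 'I_N}) 1)%N.
    by rewrite sum1_card card_ffun !card_ord.
  (* Incidences of pieces and grid points are counted in both orders. *)
  have -> : (\sum_(j < n) #|near_ j| = \sum_(i : {ffun 'I_q -> 'I_N}) \sum_(j < n) near_ j i)%N.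
    by rewrite exchange_big; apply: eq_bigr => j _; rewrite -sum1_card big_mkcond.
  apply: leq_sum => i _; have [j Hj] := cov _ (cpt i).
  rewrite (bigD1 j) //=; suff -> : near_ j i by rewrite leq_addr.
  exact/forallP.
rewrite -(ler_pM2r (exprn_gt0 q N0)) mul1r mulr_suml.
by apply: le_trans tot _; apply: ler_sum => j _; rewrite exprMn.
Qed.

(** The closed pieces may be degenerate; enlarging each radius strictly makes the original piece lie
    in an open set, so compactness applies. *)
Lemma cube_finite_subcover q (c : nat -> 'rV[R]_q) (r rho : nat -> R) :
  (forall j, r j < rho j) -> (forall j, 0 <= r j) ->
  (forall x, cube q x -> exists j, forall k, `|x 0 k - c j 0 k| <= r j) ->
  exists n, forall x, cube q x -> exists j : 'I_n, forall k, `|x 0 k - c j 0 k| < rho j.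
Proof.
move=> rrho r0 cov; have := @cube_compact R q; rewrite compact_cover.
move=> /(_ nat setT (fun j => (ball (c j) (rho j))°)).
case=> [j _|x cx|D _ HD]; first exact: open_interior.
  have [j Hj] := cov x cx; exists j => //.
  apply/nbhs_ballP; exists (rho j - r j) => /=; first by rewrite subr_gt0.
  move=> y [_ xy]; split; first exact: le_lt_trans (r0 j) (rrho j).
  move=> i k; rewrite !ord1 -ball_normE /= distrC.
  have := xy 0 k; rewrite -ball_normE /= => xyk.
  apply: (le_lt_trans (ler_distD (x 0 k) _ _)); rewrite distrC.
  by have := Hj k; move: xyk; lra.
(* The finite index set is replaced by an initial segment containing it. *)
exists (\max_(j <- finmap.enum_fset D) j).+1 => x cx; have [j jD Hj] := HD x cx.
have jn : (j < (\max_(j <- finmap.enum_fset D) j).+1)%N by rewrite ltnS (leq_bigmax_seq j).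
exists (Ordinal jn) => k /=; have [_ /(_ 0 k)] := interior_subset Hj.
by rewrite -ball_normE /= distrC.
Qed.

(** For t < q and diameters at most 1, r^q is at most r^t. A cover with small t-dimensional sum thus
    projects to a cover of the cube whose total mass is below 1, against [cube_cover_mass]. *)
Lemma graph_dimH_ge q (g : 'rV[R]_q -> R) : (0 < q)%N -> (q%:R%:E <= dimH (graph g))%E.
Proof.
move=> q0; apply: le_ereal_inf_tmp => _ [t [t0 Ht] <-]; rewrite lee_fin leNgt; apply/negP => tq.
(* Chosen so that 8^q (ep + ep) = 1/2. *)
pose ep : R := (4 * 8 ^+ q)^-1.
have e8 : 1 <= 8 ^+ q :> R by rewrite exprn_ege1 // ler1n.
have ep0 : 0 < ep by rewrite invr_gt0 mulr_gt0 // (lt_le_trans _ e8).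
have ep1 : ep <= 1 by rewrite invf_le1 ?mulr_gt0 ?(lt_le_trans _ e8) // ; lra.
have : (hcontent t 1 (graph g) < ep%:E)%E.
  apply: (@le_lt_trans _ _ 0%E); last by rewrite lte_fin.
  by rewrite -Ht; apply: ereal_sup_ubound; exists 1 => //=.
move=> /ereal_inf_lt[_ [U [FU Ud] <-]] Uep.
pose r j := fine (diam (U j)).
have rd j : diam (U j) = (r j)%:E /\ 0 <= r j <= 1 := fine_diam (Ud j).
(* Strictly positive enlargements with total [ep], since diameters may vanish. *)
pose eta j : R := ep / (2 ^ j.+1)%:R.
have eta0 j : 0 < eta j by rewrite divr_gt0 // ltr0n expn_gt0.
have eta1 j : eta j <= 1.
  by rewrite ler_pdivrMr ?ltr0n ?expn_gt0 // mul1r (le_trans ep1) // ler1n expn_gt0.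
have /choice[p Hp] j : exists p : 'rV[R]_(q + 1), forall z, U j z -> (euclid (z - p) <= r j).
  have [->|/set0P[p Up]] := eqVneq (U j) set0; first by exists 0 => z [].
  by exists p => z Uz; rewrite -lee_fin; have [<- _] := rd j; exact: euclid_le_diam.
have [||x cx|n Hn] := @cube_finite_subcover q (fun j => lsubmx (p j)) r (fun j => r j + eta j).
- by move=> j; rewrite ltrDl.
- by move=> j; have [_ /andP[]] := rd j.
- have [|j _ Uj] := FU (row_mx x (const_mx (g x))); first by exists x.
  exists j => k; rewrite mxE.
  have := coord_le_euclid (row_mx x (const_mx (g x)) - p j) (lshift 1 k).
  by rewrite mxE row_mxEl mxE => /le_trans; apply; exact: Hp.
have r01 j : 0 <= r j <= 1 by have [] := rd j.
have := @cube_cover_mass q n (fun j => lsubmx (p j)) (fun j => r j + eta j) _ Hn.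
rewrite leNgt => /(_ _)/negP; apply.
  by move=> j; have /andP[rj0 _] := r01 j; exact: ltr_wpDl.
apply: (@le_lt_trans _ _ (8 ^+ q * \sum_(j < n) (r j `^ t + eta j))).
  rewrite mulr_sumr; apply: ler_sum => j _; have /andP[rj0 rj1] := r01 j.
  have ej0 := ltW (eta0 j).
  (* The sum r + eta is at most twice the larger of the two, which turns the constant 4 into 8. *)
  apply: (@le_trans _ _ (8 ^+ q * (r j ^+ q + eta j ^+ q))).
    have [re|/ltW er] := leP (r j) (eta j).
      apply: (@le_trans _ _ ((8 * eta j) ^+ q)).
        by apply: lerXn2r; rewrite ?nnegrE ?mulr_ge0 ?addr_ge0 //; move: re; lra.
      by rewrite exprMn ler_wpM2l ?exprn_ge0 // lerDr exprn_ge0.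
    apply: (@le_trans _ _ ((8 * r j) ^+ q)).
      by apply: lerXn2r; rewrite ?nnegrE ?mulr_ge0 ?addr_ge0 //; move: er; lra.
    by rewrite exprMn ler_wpM2l ?exprn_ge0 // lerDl exprn_ge0.
  rewrite ler_wpM2l ?exprn_ge0 //; apply: lerD; last first.
    by rewrite -(prednK q0) exprS ler_piMr // exprn_ile1.
  have [->|rn0] := eqVneq (r j) 0; first by rewrite expr0n gtn_eqF // powR_ge0.
  rewrite -powR_mulrn //; apply: ger_powR; last exact: ltW.
  by rewrite rj1 lt_neqAle eq_sym rn0 rj0.
have S2 : \sum_(j < n) (r j `^ t + eta j) < ep + ep.
  (* The partial sum is dominated by the whole series, where the [eta j] add at most [ep]. *)
  rewrite -lte_fin -(big_mkord xpredT (fun j => r j `^ t + eta j)) -sumEFin.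
  have pos j : (0 <= (r j `^ t + eta j)%:E)%E.
    by rewrite lee_fin addr_ge0 ?powR_ge0 // ltW.
  apply: le_lt_trans (nneseries_lim_ge n (fun j _ _ => pos j)) _.
  have pos' j : (0 <= (r j `^ t)%:E)%E by rewrite lee_fin powR_ge0.
  apply: le_lt_trans (epsilon_trick xpredT pos' (ltW ep0)) _.
  by rewrite EFinD lteD2rE.
apply: (@lt_trans _ _ (8 ^+ q * (ep + ep))).
  by rewrite ltr_pM2l // (lt_le_trans _ e8).
have -> : 8 ^+ q * (ep + ep) = 2^-1.
  rewrite /ep; field; rewrite expf_neq0 //.
by rewrite invf_lt1 // ltr1n.
Qed.
End CubeMass.

(** * Column covers and the upper bound for the box dimension of a Hölder graph *)

Section GraphCover.
Variable R : realType.

Lemma dist_trunc_eq (u v : R) : 0 <= u -> 0 <= v -> Num.trunc u = Num.trunc v -> `|u - v| <= 1.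
Proof.
move=> u0 v0 e; have := truncn_itv u0; have := truncn_itv v0; rewrite e -natr1.
move=> /andP[h1 h2] /andP[h3 h4]; rewrite ler_distl; apply/andP; split; lra.
Qed.

(** Over a grid cell, [g] stays within beta/N of its value at the base point, so the column is cut
    into at most 2 beta + 1 layers of height 1/N. Each piece has extent at most 1/N in all q + 1
    coordinates. *)
Lemma Ncover_graph q (g : 'rV[R]_q -> R) (K sig : R) (N : nat) :
  0 <= K -> 0 < sig -> (0 < N)%N ->
  (forall x y, cube q x -> cube q y -> `|g x - g y| <= K * euclid (x - y) `^ sig) ->
  (Ncover (Num.sqrt (q + 1)%:R / N%:R) (graph g) <=
   (N.+1%:R ^+ q * (2 * (K * Num.sqrt q%:R `^ sig * N%:R `^ (1 - sig)) + 1))%:E)%E.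
Proof.
move=> K0 sig0 N0 HK; set beta := K * _ * _.
have Nr0 : 0 < N%:R :> R by rewrite ltr0n.
have b0 : 0 <= beta by rewrite !mulr_ge0 // powR_ge0.
have b20 : 0 <= 2 * beta by rewrite mulr_ge0.
pose m := (Num.trunc (2 * beta)).+1.
(* There are N + 1 cell indices per coordinate, since the integer part of N x reaches N at x = 1. *)
pose T : finType := ({ffun 'I_q -> 'I_N.+1} * 'I_m)%type.
pose base (i : {ffun 'I_q -> 'I_N.+1}) : 'rV[R]_q := \row_k ((i k)%:R / N%:R).
have cbase i : cube q (base i).
  move=> k; rewrite mxE divr_ge0 ?ler0n //= ler_pdivrMr // mul1r ler_nat.
  by rewrite -ltnS ltn_ord.
(* The shift by [beta] makes the rescaled height nonnegative, so [Num.trunc] is its integer part. *)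
pose height i x := N%:R * (g x - g (base i)) + beta.
pose W (p : T) := [set x | cube q x /\ (forall k, Num.trunc (N%:R * x 0 k) = p.1 k) /\
                           Num.trunc (height p.1 x) = p.2].
have cN (x : 'rV[R]_q) k : cube q x -> 0 <= N%:R * x 0 k.
  by move=> cx; have /andP[x0 _] := cx k; rewrite mulr_ge0.
have height_itv (i : {ffun 'I_q -> 'I_N.+1}) (x : 'rV[R]_q) :
    cube q x -> (forall k, Num.trunc (N%:R * x 0 k) = i k) ->
    0 <= height i x <= 2 * beta.
  move=> cx ix.
  have dx k : `|(x - base i) 0 k| <= N%:R^-1.
    rewrite !mxE -(ler_pM2l Nr0) divff ?gt_eqF // -{1}(gtr0_norm Nr0) -normrM mulrBr.
    have := truncn_itv (cN x k cx); rewrite ix -natr1 mulrCA divff ?gt_eqF // mulr1.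
    by move=> /andP[h1 h2]; rewrite ler_distl; apply/andP; split; lra.
  have : N%:R * `|g x - g (base i)| <= beta.
    apply: (@le_trans _ _ (N%:R * (K * (Num.sqrt q%:R * N%:R^-1) `^ sig))).
      rewrite ler_wpM2l //; apply: le_trans (HK _ _ cx (cbase i)) _; rewrite ler_wpM2l //.
      apply: powR_le; [exact: ltW|exact: euclid_ge0|].
      by apply: euclid_le_coord => //; rewrite invr_ge0.
    rewrite powR_div // /beta powRB; last by rewrite (gt_eqF Nr0) implybT.
    by rewrite powRr1 // le_eqVlt; apply/orP; left; apply/eqP; ring.
  rewrite /height -{1}(gtr0_norm Nr0) -normrM ler_norml => /andP[h1 h2].
  by apply/andP; split; lra.
pose U (j : 'I_#|T|) := [set row_mx x (const_mx (g x)) | x in W (enum_val j)] : set 'rV[R]_(q + 1).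
apply: (@le_trans _ _ (#|T|%:R)%:E).
  apply: ereal_inf_lbound; exists #|T| => //; exists U; split.
    move=> _ [x cx <-].
    pose i : {ffun 'I_q -> 'I_N.+1} := [ffun k => inord (Num.trunc (N%:R * x 0 k))].
    have ix k : Num.trunc (N%:R * x 0 k) = i k.
      rewrite ffunE inordK // ltnS -[leqRHS](natrK (R := R)) le_truncn // ler_piMr //.
      by have /andP[] := cx k.
    have hi : (Num.trunc (height i x) < m)%N.
      by rewrite ltnS le_truncn //; have /andP[] := height_itv i x cx ix.
    exists (enum_rank (i, Ordinal hi)) => //; exists x => //.
    by rewrite enum_rankK.
  move=> j; apply: diam_le; first by rewrite divr_ge0.
  move=> _ _ [x [cx [ix hx]] <-] [y [cy [iy hy]] <-].
  apply: euclid_le_coord; first by rewrite invr_ge0.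
  move=> k; rewrite -(ler_pM2l Nr0) divff ?gt_eqF // -{1}(gtr0_norm Nr0) -normrM.
  case: (split_ordP k) => l ->.
    rewrite mxE row_mxEl mxE row_mxEl mulrBr; apply: dist_trunc_eq; [exact: cN|exact: cN|].
    by rewrite ix iy.
  rewrite mxE row_mxEr mxE [X in _ + X]mxE row_mxEr mxE.
  have -> : N%:R * (g x - g y) = height (enum_val j).1 x - height (enum_val j).1 y.
    by rewrite /height; ring.
  apply: dist_trunc_eq; last by rewrite hx hy.
    by have /andP[] := height_itv _ x cx ix.
  by have /andP[] := height_itv _ y cy iy.
rewrite lee_fin card_prod card_ffun !card_ord natrM natrX ler_wpM2l ?exprn_ge0 //.
by rewrite /m -natr1 lerD2r truncn_le.
Qed.

(** The constant [C] adds only ln C / (- ln d) to the ratio, and this tends to 0 with [d]. *)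
Lemma upper_box_le n (F : set 'rV[R]_n) (D C : R) : F !=set0 -> 0 < C ->
  (forall d, 0 < d < 1 -> (Ncover d F <= (C * d `^ (- D))%:E)%E) -> (upper_box F <= D%:E)%E.
Proof.
move=> F0 C0 H; apply/lee_addgt0Pr => e e0.
(* Below this threshold |ln C| + 1 is less than e (- ln d). *)
pose e1 := Num.min 2^-1 (expR (- ((`|ln C| + 1) / e))).
have e10 : 0 < e1 by rewrite lt_min invr_gt0 ltr0n expR_gt0.
have e11 : e1 < 1 by rewrite gt_min invf_lt1 // ltr1n.
apply: (@le_trans _ _ (ereal_sup [set box_ratio F d | d in [set d | 0 < d < e1]])).
  by apply: ereal_inf_lbound; exists e1 => //=; rewrite e10.
apply: ge_ereal_sup => _ [d /andP[d0 de1] <-].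
have d01 : 0 < d < 1 by rewrite d0 (lt_trans de1).
have := H d d01; have := Ncover_ge1 d F0; rewrite /box_ratio.
case: Ncover => [r| |] //=; rewrite !lee_fin => r1 rC.
rewrite ?lee_fin.
have l0 : 0 < - ln d by rewrite oppr_gt0 ln_lt0.
rewrite ler_pdivrMr //.
have : ln r <= ln (C * d `^ (- D)).
  rewrite ler_ln // posrE; last by rewrite mulr_gt0 // powR_gt0.
  exact: lt_le_trans r1.
rewrite lnM ?posrE ?powR_gt0 // ln_powR => hr.
have : ln d < - ((`|ln C| + 1) / e).
  rewrite -[ltRHS]expRK ltr_ln ?posrE ?expR_gt0 //.
  by move: de1; rewrite lt_min => /andP[].
rewrite ltrNr ltr_pdivrMr // => hd.
have := ler_norm (ln C); move: hr hd.
by rewrite mulrDl mulNr mulrN; lra.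
Qed.

(** Any scale [d] is compared with a grid mesh: c0/N is at most [d] while N is at most 2 c0/d, so
    the grid count becomes a constant times d^-D. *)
Lemma graph_upper_box_le q (g : 'rV[R]_q -> R) (sig : R) : 0 < sig <= 1 ->
  holder_on sig g -> (upper_box (graph g) <= (q%:R + 1 - sig)%:E)%E.
Proof.
move=> /andP[sig0 sig1] /holder_ex_ge0[K K0 HK].
pose c0 : R := Num.sqrt (q + 1)%:R.
have c01 : 1 <= c0.
  by rewrite -[1]sqrtr1 ler_sqrt ?ler0n // ler1n addn1.
have c00 : 0 < c0 := lt_le_trans ltr01 c01.
pose B := K * Num.sqrt q%:R `^ sig.
have B0 : 0 <= B by rewrite mulr_ge0 // powR_ge0.
pose D := q%:R + 1 - sig.
have D0 : 0 <= D by rewrite /D -addrA addr_ge0 // subr_ge0.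
have B10 : 0 < 2 * B + 1 by rewrite ltr_wpDl // mulr_ge0.
apply: (@upper_box_le _ _ _ (2 ^+ q * (2 * B + 1) * (2 * c0) `^ D)).
- exists (row_mx 0 (const_mx (g 0))); exists 0 => // k.
  by rewrite mxE lexx ler01.
- by rewrite !mulr_gt0 ?exprn_gt0 ?powR_gt0 // mulr_gt0.
move=> d /andP[d0 d1].
pose N := (Num.trunc (c0 / d)).+1.
have cd0 : 0 <= c0 / d by rewrite divr_ge0 // ltW.
have cd1 : 1 <= c0 / d by rewrite ler_pdivlMr // mul1r (le_trans (ltW d1)).
have N1 : 1 <= N%:R :> R by rewrite ler1n.
have N0 : 0 < N%:R :> R by rewrite ltr0n.
have dN : c0 / N%:R <= d.
  by rewrite ler_pdivrMr // mulrC -ler_pdivrMr // ltW // truncnS_gt.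
have Ncd : N%:R <= 2 * c0 / d.
  rewrite /N -natr1; have : (Num.trunc (c0 / d))%:R <= c0 / d by rewrite truncn_le.
  by rewrite -mulrA; move: cd1; lra.
apply: (@le_trans _ _ (Ncover (c0 / N%:R) (graph g))).
  apply: ereal_inf_le_tmp => _ [m [U [FU Ud]] <-]; exists m => //; exists U; split=> // i.
  by apply: le_trans (Ud i) _; rewrite lee_fin.
apply: le_trans (Ncover_graph K0 sig0 (ltn0Sn _) HK) _; rewrite -/B -/N lee_fin.
(* As sig is at most 1, the lone summand 1 in the layer count is absorbed into N^(1 - sig). *)
have Ns1 : 1 <= N%:R `^ (1 - sig) :> R.
  by rewrite -[leLHS](powRr0 N%:R) ler_powR // subr_ge0.
apply: (@le_trans _ _ (2 ^+ q * (2 * B + 1) * N%:R `^ D)).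
  have -> : N%:R `^ D = N%:R ^+ q * N%:R `^ (1 - sig) :> R.
    by rewrite -powR_mulrn ?ler0n // -powRD ?(gt_eqF N0) ?implybT // /D addrA.
  apply: (@le_trans _ _ ((2 * N%:R) ^+ q * ((2 * B + 1) * N%:R `^ (1 - sig)))); last first.
    by rewrite exprMn le_eqVlt; apply/orP; left; apply/eqP; ring.
  apply: ler_pM; [by rewrite exprn_ge0| | |].
  - by rewrite addr_ge0 // mulr_ge0 // mulr_ge0 // powR_ge0.
  - by apply: lerXn2r; rewrite ?nnegrE ?mulr_ge0 // -natr1; move: N1; lra.
  - by rewrite [leRHS]mulrDl mul1r mulrA lerD2l.
have -> : 2 ^+ q * (2 * B + 1) * (2 * c0) `^ D * d `^ (- D) =
          2 ^+ q * (2 * B + 1) * (2 * c0 / d) `^ D.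
  by rewrite powR_div ?mulr_ge0 ?(ltW c00) ?(ltW d0) // powRN mulrA.
rewrite ler_wpM2l //; first by rewrite mulr_ge0 ?exprn_ge0 // ltW.
by apply: powR_le; rewrite ?ler0n.
Qed.
End GraphCover.

(** * Hölder continuity of the fractal function and the chain of dimension inequalities *)

Theorem theorem4p9 (R : realType) (q : nat) (hq : (0 < q)%N)
  (M : 'I_q -> nat) (hM : forall k, (2 <= M k)%N)
  (xs : 'I_q -> nat -> R)
  (hx0 : forall k, xs k 0%N = 0) (hxM : forall k, xs k (M k) = 1)
  (hxinc : forall k (i : nat), (i < M k)%N -> xs k i < xs k i.+1)
  (sig : R) (hsig : 0 < sig <= 1)
  (f alpha s : 'rV[R]_q -> R)
  (hf : holder_on sig f) (halpha : holder_on sig alpha) (hs : holder_on sig s)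
  (hvert : forall j : 'I_q -> bool,
     s (\row_k xs k (if j k then M k else 0%N))
     = f (\row_k xs k (if j k then M k else 0%N)))
  (hcond : Num.max (supnorm alpha / amin M xs `^ sig)
                   (supnorm alpha + holder_semi sig alpha) < 1)
  (falpha : 'rV[R]_q -> R)
  (hcont : {within cube q, continuous falpha})
  (hfe : forall (idx : 'I_q -> nat), (forall k, (1 <= idx k <= M k)%N) ->
     forall x : 'rV[R]_q,
       (forall k, xs k (idx k).-1 <= x 0 k <= xs k (idx k)) ->
       falpha x = f x + alpha x * (falpha (u_inv xs idx x) - s (u_inv xs idx x))) :
  holder_on sig falpha /\
  ((q%:R)%:E <= dimH (graph falpha))%E /\
  (dimH (graph falpha) <= lower_box (graph falpha))%E /\
  (lower_box (graph falpha) <= upper_box (graph falpha))%E /\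
  (upper_box (graph falpha) <= (q%:R + 1 - sig)%:E)%E.
Proof.
have /andP[sig0 _] := hsig.
have hol : holder_on sig falpha.
  have [Kf Kf0 HKf] := holder_ex_ge0 hf.
  have [Ka Ka0 HKa] := holder_ex_ge0 halpha.
  have [Ks Ks0 HKs] := holder_ex_ge0 hs.
  have [Bg Bg0 HBg] := continuous_cube_bounded hcont.
  have [Bs Bs0 HBs] := holder_cube_bounded sig0 hs.
  have [Ba _ HBa] := holder_cube_bounded sig0 halpha.
  have HA x (cx : cube q x) := supnorm_ge HBa cx.
  have A0 : 0 <= supnorm alpha.
    apply: le_trans (normr_ge0 (alpha 0)) (HA 0 _) => k.
    by rewrite mxE lexx ler01.
  (* The first entry of the maximum is the contraction condition, with the supremum of |alpha| in
     the role of [A]. *)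
  move: hcond; rewrite gt_max => /andP[hA _].
  exact: (self_affine_holder hq hM hx0 hxM hxinc sig0 Kf0 Ka0 Ks0 Bg0 Bs0 A0
            HKf HKa HKs HBg HBs HA hA hfe).
split=> //; split; first exact: graph_dimH_ge.
split; last by split; [exact: lower_le_upper_box|exact: graph_upper_box_le].
apply: dimH_le_lower_box; exists (row_mx 0 (const_mx (falpha 0))); exists 0 => // k.
by rewrite mxE lexx ler01.
Qed.
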